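(* Let $G$ be a $3$-tree. Then $\tau(G)\leq \frac{9}{5}\,\nu(G)+\frac{1}{5}$.
   Context: A $3$-tree is a graph obtained from $K_3$ by successively choosing a triangle in the current graph and adding a new vertex adjacent to its three vertices (any finite number of times, possibly zero). $\tau(G)$ is the minimum size of a set of edges of $G$ whose removal leaves a triangle-free graph, and $\nu(G)$ is the maximum number of pairwise edge-disjoint triangles in $G$. *)

(* Defs.v *)
(* Simple graphs: symmetric irreflexive e : rel T on T : finType. *)
From mathcomp Require Import all_boot all_order all_algebra.
Set Implicit Arguments. Unset Strict Implicit. Unset Printing Implicit Defensive.

Section Graph.
Variables (T : finType) (e : rel T).

Definition is_triangle (t : {set T}) : bool :=
  (#|t| == 3) && [forall x in t, forall y in t, (x != y) ==> e x y].

Definition edges : {set {set T}} :=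
  [set [set p.1; p.2] | p in [set q : T * T | e q.1 q.2]].

Definition hits_all_triangles (F : {set {set T}}) : bool :=
  [forall t : {set T}, is_triangle t ==>
     [exists x in t, exists y in t, (x != y) && ([set x; y] \in F)]].

(* tau(G): minimum size of a set of edges whose removal leaves G
   triangle-free (the full edge set always qualifies, so it is the default). *)
Definition tau : nat :=
  \big[minn/#|edges|]_(F : {set {set T}} | (F \subset edges) && hits_all_triangles F)
     #|F|.

(* Edge-disjoint triangle packings: distinct triangles share at most one vertex. *)
Definition triangle_packing (P : {set {set T}}) : bool :=
  [forall t in P, is_triangle t] &&
  [forall t1 in P, forall t2 in P, (t1 != t2) ==> (#|t1 :&: t2| <= 1)].

Definition nu : nat :=
  \max_(P : {set {set T}} | triangle_packing P) #|P|.

(* G is a 3-tree: its vertices can be listed as a, b, c, v_3, ..., v_{n-1}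
   (each vertex exactly once) such that a, b, c form a triangle and every
   later vertex v_i is adjacent, among the earlier vertices, to exactly three
   vertices which form a triangle.  This is exactly the construction sequence
   "start from K_3, repeatedly add a vertex joined to a triangle". *)
Definition is_3tree : Prop :=
  exists (a b c : T) (rest : seq T),
    let s := [:: a, b, c & rest] in
    [/\ uniq s, (forall x : T, x \in s),
        [&& e a b, e b c & e a c] &
        forall i, 3 <= i < size s ->
          exists p q r : T,
            [/\ [set y in take i s | e (nth a s i) y] = [set p; q; r],
                [&& p != q, q != r & p != r] &
                [&& e p q, e q r & e p r]]].

End Graph.

(* Main.v *)
Require Import Defs.
From mathcomp Require Import all_boot all_order all_algebra.
From mathcomp Require Import zify lra.
Import Order.TTheory GRing.Theory Num.Theory.
Local Open Scope nat_scope.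

(** Give every triangle a weight: a price [cost k] to pay when [k] of its edges
are deleted, and a reward [gain k] when [k] of its edges are reserved for it.
Deleting an edge costs 5 and each edge is reserved for at most one triangle.
If all triangles carry [triangle_weight], the least total cost is
5 tau and the largest total gain is 9 nu, so it suffices to find a deletion and
a reservation with total cost at most the total gain plus 1.
Vertices are eliminated from the last one on: seen from the triangle pqr to which
the last vertex v is attached, the weighted triangles pqr, vpq, vqr, vrp
together are at least as good as a single weight on pqr.  Up to a common additive
constant on both components, six weights suffice, which is a finite check. *)

(** * Weights on triangles and their monotonicity *)

Definition weight : Type := (seq nat * seq nat)%type.
Definition cost (w : weight) (k : nat) : nat := nth 0 w.1 k.
Definition gain (w : weight) (k : nat) : nat := nth 0 w.2 k.

Definition triangle_weight : weight := ([:: 5; 0; 0; 0], [:: 0; 0; 0; 9]).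

(* The two components of a weight are only compared with each other, so they are
   shifted jointly to be natural numbers.  Both lists were found by iterating the
   elimination step from [triangle_weight], keeping only the worst weights and
   replacing them by the worst weights depending on the number of edges alone. *)
Definition weights : seq weight :=
  [:: triangle_weight;
      ([:: 10; 5; 5; 0], [:: 0; 9; 9; 9]);
      ([:: 10; 5; 5; 0], [:: 4; 4; 13; 13]);
      ([:: 15; 10; 5; 0], [:: 0; 9; 18; 18]);
      ([:: 15; 10; 5; 0], [:: 4; 13; 13; 22]);
      ([:: 15; 10; 5; 0], [:: 8; 8; 17; 17])].

(** Summaries of the three triangles at a new vertex, before the weight of the triangle it is
    attached to is added. The last two lie outside [weights]; merging leads back into it. *)
Definition apex_weights : seq weight :=
  [:: ([:: 10; 5; 5; 0], [:: 0; 9; 9; 9]);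
      ([:: 10; 5; 5; 0], [:: 4; 4; 13; 13]);
      ([:: 10; 5; 5; 0], [:: 8; 8; 8; 17]);
      ([:: 5; 5; 5; 0], [:: 7; 7; 7; 16])].

(** Monotonicity allows lower bounds on edge counts to replace exact counts in the elimination
    step. *)
Lemma leq_cost (w : weight) (i j : nat) :
  w \in weights -> i <= j <= 3 -> cost w j <= cost w i.
Proof.
move=> w_in /andP[le_ij le_j3].
have /allP/(_ w w_in)/andP[w_sorted /eqP w_size] :
  all (fun w => sorted geq w.1 && (size w.1 == 4)) weights by [].
have geq_trans : transitive geq by move=> a b c /= ba ac; apply: leq_trans ac ba.
by apply: (sorted_leq_nth geq_trans leqnn 0 w_sorted); rewrite ?inE ?w_size //; lia.
Qed.

Lemma leq_gain (w : weight) (i j : nat) :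
  w \in weights -> i <= j <= 3 -> gain w i <= gain w j.
Proof.
move=> w_in /andP[le_ij le_j3].
have /allP/(_ w w_in)/andP[w_sorted /eqP w_size] :
  all (fun w => sorted leq w.2 && (size w.2 == 4)) weights by [].
by apply: (sorted_leq_nth leq_trans leqnn 0 w_sorted); rewrite ?inE ?w_size //; lia.
Qed.

(** * Finite checks for the elimination of one vertex *)

Definition bmin (f : bool -> nat) : nat := minn (f false) (f true).
Definition bmax (f : bool -> nat) : nat := maxn (f false) (f true).
Definition ball (f : bool -> bool) : bool := f false && f true.

Definition bmin3 (f : bool -> bool -> bool -> nat) : nat :=
  bmin (fun a => bmin (fun b => bmin (f a b))).
Definition bmax3 (f : bool -> bool -> bool -> nat) : nat :=
  bmax (fun a => bmax (fun b => bmax (f a b))).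
Definition ball3 (f : bool -> bool -> bool -> bool) : bool :=
  ball (fun a => ball (fun b => ball (f a b))).

(** The value is named [m] so that, applied to [erefl], the result rewrites a folded term such as
    [merge_cost]. *)
Lemma bmin3_attained f m : bmin3 f = m -> exists a b c, m = f a b c.
Proof.
move=> <-.
have bminE g : exists b, bmin g = g b.
  by rewrite /bmin; case: leqP => _; [exists false | exists true].
have [a abE] := bminE (fun a => bmin (fun b => bmin (f a b))).
have [b bcE] := bminE (fun b => bmin (f a b)); have [c cE] := bminE (f a b).
by exists a, b, c; rewrite /bmin3 abE bcE cE.
Qed.

Lemma bmax3_attained f m : bmax3 f = m -> exists a b c, m = f a b c.
Proof.
move=> <-.
have bmaxE g : exists b, bmax g = g b.
  by rewrite /bmax; case: leqP => _; [exists true | exists false].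
have [a abE] := bmaxE (fun a => bmax (fun b => bmax (f a b))).
have [b bcE] := bmaxE (fun b => bmax (f a b)); have [c cE] := bmaxE (f a b).
by exists a, b, c; rewrite /bmax3 abE bcE cE.
Qed.

Lemma ball3P f : ball3 f -> forall a b c, f a b c.
Proof. by move=> /andP[/andP[/andP[? ?] /andP[? ?]] /andP[/andP[? ?] /andP[? ?]]] [] [] []. Qed.

(* The booleans tell, for each edge of a triangle, whether it is deleted ([x1], [x2],
   [x3]) or available for reservation ([y1], [y2], [y3]).  Comparing all values at
   once hides the common additive constant between the pair [c], [g] and [w]. *)
Definition replaceable (c g : bool -> bool -> bool -> nat) (w : weight) : bool :=
  ball3 (fun x1 x2 x3 => ball3 (fun y1 y2 y3 =>
    c x1 x2 x3 + gain w (y1 + y2 + y3) <= g y1 y2 y3 + cost w (x1 + x2 + x3))).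

(* [w1], [w2], [w3] sit on vpq, vqr, vrp; the edges [x1], [x2], [x3] are pq, qr, rp and
   [z1], [z2], [z3] are vp, vq, vr.  Below, [a1] reserves vp for vpq rather than vrp,
   [a2] reserves vq for vpq rather than vqr, and [a3] vr for vqr rather than vrp. *)
Definition apex_cost (w1 w2 w3 : weight) (x1 x2 x3 : bool) : nat :=
  bmin3 (fun z1 z2 z3 => 5 * (z1 + z2 + z3) + cost w1 (x1 + z1 + z2) +
    cost w2 (x2 + z2 + z3) + cost w3 (x3 + z3 + z1)).

Definition apex_gain (w1 w2 w3 : weight) (y1 y2 y3 : bool) : nat :=
  bmax3 (fun a1 a2 a3 => gain w1 (y1 + a1 + a2) +
    gain w2 (y2 + ~~ a2 + a3) + gain w3 (y3 + ~~ a3 + ~~ a1)).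

Lemma apex_replaceable w1 w2 w3 :
    w1 \in weights -> w2 \in weights -> w3 \in weights ->
  exists2 w, w \in apex_weights &
    replaceable (apex_cost w1 w2 w3) (apex_gain w1 w2 w3) w.
Proof.
move=> w1_in w2_in w3_in; apply/hasP; move: w3 w3_in; apply/allP.
move: w2 w2_in; apply/allP; move: w1 w1_in; apply/allP.
by vm_compute.
Qed.

(* [u1], [u2], [u3] delete further edges of the common triangle; [v1], [v2], [v3] pass
   edges on from [w] to [w']. *)
Definition merge_cost (w w' : weight) (x1 x2 x3 : bool) : nat :=
  bmin3 (fun u1 u2 u3 => let k := (x1 || u1) + (x2 || u2) + (x3 || u3) in
    5 * (u1 + u2 + u3) + cost w k + cost w' k).

Definition merge_gain (w w' : weight) (y1 y2 y3 : bool) : nat :=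
  bmax3 (fun v1 v2 v3 =>
    gain w ((y1 && ~~ v1) + (y2 && ~~ v2) + (y3 && ~~ v3)) +
    gain w' ((y1 && v1) + (y2 && v2) + (y3 && v3))).

(** Together with [apex_replaceable], this closes [weights] under elimination of a vertex; both are
    exhaustive computations. *)
Lemma merge_replaceable w w' : w \in weights -> w' \in apex_weights ->
  exists2 w'', w'' \in weights & replaceable (merge_cost w w') (merge_gain w w') w''.
Proof.
move=> w_in w'_in; apply/hasP; move: w' w'_in; apply/allP; move: w w_in; apply/allP.
by vm_compute.
Qed.

(** The optimal merge fixes [u] and [v]; the apex is then optimised with deletions [x || u] and
    passed edges [y && v]. Adding the two inequalities cancels the intermediate weight [w']. The
    weight [w] precedes the booleans because the induction hypothesis needs it before it yields a
    deletion and a reservation. *)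
Lemma absorb_vertex w0 w1 w2 w3 :
    w0 \in weights -> w1 \in weights -> w2 \in weights -> w3 \in weights ->
  exists2 w, w \in weights & forall x1 x2 x3 y1 y2 y3 : bool,
  exists u1 u2 u3 z1 z2 z3 v1 v2 v3 a1 a2 a3 : bool,
    5 * (u1 + u2 + u3 + z1 + z2 + z3)
    + cost w0 ((x1 || u1) + (x2 || u2) + (x3 || u3))
    + cost w1 ((x1 || u1) + z1 + z2)
    + cost w2 ((x2 || u2) + z2 + z3)
    + cost w3 ((x3 || u3) + z3 + z1)
    + gain w (y1 + y2 + y3)
    <= gain w0 ((y1 && ~~ v1) + (y2 && ~~ v2) + (y3 && ~~ v3))
     + gain w1 ((y1 && v1) + a1 + a2)
     + gain w2 ((y2 && v2) + ~~ a2 + a3)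
     + gain w3 ((y3 && v3) + ~~ a3 + ~~ a1)
     + cost w (x1 + x2 + x3).
Proof.
move=> w0_in w1_in w2_in w3_in.
have [w' w'_in apexP] := apex_replaceable _ _ _ w1_in w2_in w3_in.
have [w w_in mergeP] := merge_replaceable _ _ w0_in w'_in.
exists w => // x1 x2 x3 y1 y2 y3.
have := ball3P _ (ball3P _ mergeP x1 x2 x3) y1 y2 y3.
have [u1 [u2 [u3 ->]]] := bmin3_attained _ _ (erefl (merge_cost w0 w' x1 x2 x3)).
have [v1 [v2 [v3 ->]]] := bmax3_attained _ _ (erefl (merge_gain w0 w' y1 y2 y3)).
have := ball3P _ (ball3P _ apexP (x1 || u1) (x2 || u2) (x3 || u3))
  (y1 && v1) (y2 && v2) (y3 && v3).
have [z1 [z2 [z3 ->]]] := bmin3_attained _ _ 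
  (erefl (apex_cost w1 w2 w3 (x1 || u1) (x2 || u2) (x3 || u3))).
have [a1 [a2 [a3 ->]]] := bmax3_attained _ _ 
  (erefl (apex_gain w1 w2 w3 (y1 && v1) (y2 && v2) (y3 && v3))).
move=> /= apex_le merge_le.
exists u1, u2, u3, z1, z2, z3, v1, v2, v3, a1, a2, a3; move: apex_le merge_le.
do !move: (cost _ _) => ?; do !move: (gain _ _) => ?; do !move: (nat_of_bool _) => ?.
lia.
Qed.

(** * Edges and triangles of a graph *)

Section Elimination.

Variables (T : finType) (e : rel T).
Hypotheses (e_sym : symmetric e) (e_irr : irreflexive e).

(* In a triangle [D], the sets [D :\ x] are exactly the three edges. *)
Definition edge_count (Q : pred {set T}) (D : {set T}) : nat :=
  \sum_(x in D) Q (D :\ x).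

Lemma edge_count_card Q D : edge_count Q D <= #|D|.
Proof. by rewrite -sum1_card; apply: leq_sum => x _; apply: leq_b1. Qed.

Lemma set3D1 (x y z : T) : x != y -> y != z -> x != z ->
  [/\ [set x; y; z] :\ x = [set y; z], [set x; y; z] :\ y = [set x; z]
    & [set x; y; z] :\ z = [set x; y]].
Proof.
move=> /negPf xy /negPf yz /negPf xz.
by split; apply/setP => w; rewrite !inE; case: (eqVneq w x) => [->|_] //=;
  rewrite ?xy ?xz ?andbT //; case: (eqVneq w y) => [->|_] //=;
  rewrite ?yz ?andbT ?andNb ?orbF.
Qed.

Lemma edge_count3 Q (x y z : T) : x != y -> y != z -> x != z ->
  edge_count Q [set x; y; z] = Q [set x; y] + Q [set y; z] + Q [set x; z].
Proof.
move=> xy yz xz; have [Dx Dy Dz] := set3D1 _ _ _ xy yz xz.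
rewrite /edge_count [in X in \sum_(_ in X) _]setUC big_setU1 /=; last first.
  by rewrite !inE negb_or eq_sym xz eq_sym.
rewrite big_setU1 /=; last by rewrite inE.
by rewrite big_set1 Dx Dy Dz; lia.
Qed.

Lemma leq_edge_count (Q Q' : pred {set T}) (D : {set T}) :
  {in D, forall x, Q (D :\ x) -> Q' (D :\ x)} -> edge_count Q D <= edge_count Q' D.
Proof.
move=> QQ'; apply: leq_sum => x xD.
by case: (Q _) (QQ' x xD) => // ->.
Qed.

Definition triangles (V : {set T}) : {set {set T}} :=
  [set D | is_triangle e D & D \subset V].

Lemma cardsD1_3 (A : {set T}) x : #|A| = 3 -> x \in A -> #|A :\ x| = 2.
Proof. by move=> A_card xA; move: (cardsD1 x A); rewrite xA A_card => -[]. Qed.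

Lemma triangle_card D : is_triangle e D -> #|D| = 3.
Proof. by case/andP => /eqP. Qed.

Lemma triangle_adj D x y : is_triangle e D -> x \in D -> y \in D -> x != y -> e x y.
Proof. by case/andP => _ /forall_inP/(_ x)/[apply]/forall_inP/(_ y)/[apply]/implyP. Qed.

Lemma is_triangle3 x y z : e x y -> e y z -> e x z -> is_triangle e [set x; y; z].
Proof.
move=> xy yz xz; apply/andP; split.
  rewrite -setUA !cardsU1 cards1 !inE.
  have ne u w : e u w -> (u == w) = false.
    by move=> uw; apply/eqP => eq_uw; rewrite eq_uw e_irr in uw.
  by rewrite !ne.
apply/forall_inP => u; rewrite !inE => /orP[/orP[]|] /eqP -> {u};
  apply/forall_inP => w; rewrite !inE => /orP[/orP[]|] /eqP ->;
  by rewrite ?eqxx // ?[e y x]e_sym ?[e z _]e_sym ?xy ?yz ?xz ?implybT.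
Qed.

(** * Deletions, reservations and the induction over vertices *)

Definition cut_count (F : {set {set T}}) (D : {set T}) : nat :=
  edge_count [in F] D.

(* [phi] sends an edge to the triangle it is reserved for; being a function, it
   reserves no edge twice. *)
Definition owned_count (phi : {set T} -> {set T}) (D : {set T}) : nat :=
  edge_count (fun f => phi f == D) D.

(** Quantifying over all weightings from [weights] makes the induction possible, since each
    elimination changes the weight of one triangle. *)
Definition balanced (V : {set T}) : Prop :=
  forall sigma : {set T} -> weight, (forall D, sigma D \in weights) ->
  exists (F : {set {set T}}) (phi : {set T} -> {set T}),
    F \subset edges e /\
    5 * #|F| + \sum_(D in triangles V) cost (sigma D) (cut_count F D)
    <= \sum_(D in triangles V)
         gain (sigma D) (owned_count phi D) + 1.

(** Nothing is deleted and all three edges are reserved for the only triangle. The additive 1 is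
    consumed here: the second weight has cost 10 against gain 9. *)
Lemma balanced_triangle a b c : e a b -> e b c -> e a c ->
  balanced [set a; b; c].
Proof.
move=> ab bc ac sigma sigma_in; exists set0, (fun=> [set a; b; c]).
split; first exact: sub0set.
have abc_tri := is_triangle3 _ _ _ ab bc ac.
have -> : triangles [set a; b; c] = [set [set a; b; c]].
  apply/setP => D; rewrite !inE; apply/andP/eqP => [[D_tri D_sub] | ->]; last by [].
  by apply/eqP; rewrite eqEcard D_sub (triangle_card _ D_tri) (triangle_card _ abc_tri).
rewrite !big_set1 cards0 muln0 add0n.
rewrite /cut_count [in leqLHS]/edge_count big1 => [|x _]; last by rewrite inE.
rewrite /owned_count [in leqRHS]/edge_count (eq_bigr (fun=> 1)) => [|x _]; last by rewrite eqxx.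
rewrite sum1_card (triangle_card _ abc_tri).
have /allP/(_ _ (sigma_in [set a; b; c])) :
  all (fun w => cost w 0 <= gain w 3 + 1) weights by [].
by [].
Qed.

Lemma triangles_setU1 (V : {set T}) v p q r :
    v \notin V -> [set y in V | e v y] = [set p; q; r] ->
    e p q -> e q r -> e p r ->
  forall g : {set T} -> nat,
  \sum_(D in triangles (v |: V)) g D =
    g [set v; p; q] + (g [set v; q; r] + (g [set v; r; p] +
    (g [set p; q; r] + \sum_(D in triangles V | D != [set p; q; r]) g D))).
Proof.
move=> vV nbrs pq qr pr g.
have ne u w : e u w -> u != w.
  by move=> uw; apply/eqP => eq_uw; rewrite eq_uw e_irr in uw.
have nbrE y : (y \in V) && e v y = (y \in [set p; q; r]) by rewrite -nbrs inE.
have [/andP[pV vp] /andP[qV vq] /andP[rV vr]] :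
    [/\ (p \in V) && e v p, (q \in V) && e v q & (r \in V) && e v r].
  by rewrite !nbrE !inE !eqxx !orbT.
set N := [set p; q; r].
have /negPf pvF : p != v by apply: contraNneq vV => <-.
have /negPf qvF : q != v by apply: contraNneq vV => <-.
have /negPf rvF : r != v by apply: contraNneq vV => <-.
have [Np Nq Nr] := set3D1 _ _ _ (ne _ _ pq) (ne _ _ qr) (ne _ _ pr).
have N_card : #|N| = 3 by exact: triangle_card (is_triangle3 _ _ _ pq qr pr).
have NV : N \subset V by apply/subsetP => y; rewrite -nbrE => /andP[].
have vN : v \notin N by apply: contra vV; apply: (subsetP NV).
set D1 := [set v; p; q]; set D2 := [set v; q; r]; set D3 := [set v; r; p].
have DE : [/\ D1 = v |: N :\ r, D2 = v |: N :\ p & D3 = v |: N :\ q].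
  by rewrite /N Np Nq Nr [[set p; r]]setUC /D1 /D2 /D3 -!setUA.
have triE : triangles (v |: V) = D1 |: (D2 |: (D3 |: triangles V)).
  apply/setP => D; rewrite !inE; apply/idP/idP; last first.
    have sub x : v |: N :\ x \subset v |: V.
      by apply: setUS; apply: subset_trans NV; apply: subsetDl.
    case: DE => D1E D2E D3E.
    case/or4P => [/eqP->|/eqP->|/eqP->|/andP[-> D_sub]].
    - by rewrite {2}D1E sub is_triangle3.
    - by rewrite {2}D2E sub is_triangle3.
    - by rewrite {2}D3E sub is_triangle3 // e_sym.
    by rewrite (subset_trans D_sub) ?subsetU1.
  case/andP => D_tri D_sub; have [vD|vD] := boolP (v \in D); last first.
    apply/or4P; constructor 4; rewrite D_tri; apply/subsetP => y yD.
    move: (subsetP D_sub y yD); rewrite !inE => /orP[/eqP y_v|//].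
    by rewrite -y_v yD in vD.
  have D_card := triangle_card _ D_tri.
  (* A triangle through [v] has only two further vertices, both in [N], so it misses exactly one
     vertex of [N]. *)
  have [x xN xD] : exists2 x, x \in N & x \notin D.
    apply/subsetPn; apply/negP => ND.
    have : v |: N \subset D by rewrite subUset sub1set vD ND.
    by move=> /subset_leq_card; rewrite cardsU1 vN N_card D_card.
  have D_eq : D = v |: N :\ x.
    have Nx_card : #|N :\ x| = 2 by exact: cardsD1_3.
    apply/eqP; rewrite eqEcard D_card cardsU1 in_setD1 (negPf vN) andbF Nx_card andbT.
    apply/subsetP => y yD; rewrite in_setU1 in_setD1 -nbrE.
    have -> /= : y != x by apply: contraNneq xD => <-.
    case: (eqVneq y v) => //= y_v.
    move: (subsetP D_sub y yD); rewrite !inE (negPf y_v) /= => -> /=.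
    by apply: triangle_adj D_tri vD yD _; rewrite eq_sym.
  case: DE => -> -> ->; rewrite D_eq; move: xN; rewrite !inE.
  by rewrite -orbA => /or3P[] /eqP ->; rewrite eqxx ?orbT.
have vD_notin (D : {set T}) : v \in D -> D \notin triangles V.
  by move=> vD; rewrite inE negb_and orbC (contra _ vV) // => /subsetP/(_ v vD).
have neqD x (A B : {set T}) : x \in A -> x \notin B -> A != B.
  by move=> xA xB; apply: contraNneq xB => <-.
have qD3 : q \notin D3.
  by rewrite !inE qvF (negPf (ne _ _ qr)) eq_sym (negPf (ne _ _ pq)).
have D12 : D1 != D2.
  by apply: (neqD p); rewrite !inE ?eqxx ?orbT // pvF !negb_or (ne _ _ pq) (ne _ _ pr).
have D13 : D1 != D3 by apply: neqD qD3; rewrite !inE eqxx orbT.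
have D23 : D2 != D3 by apply: neqD qD3; rewrite !inE eqxx orbT.
have vD1 : v \in D1 by rewrite !inE eqxx.
have vD2 : v \in D2 by rewrite !inE eqxx.
have vD3 : v \in D3 by rewrite !inE eqxx.
rewrite triE !big_setU1 /=; first last.
- by rewrite !in_setU1 !negb_or D12 D13 vD_notin.
- by rewrite !in_setU1 !negb_or D23 vD_notin.
- by rewrite vD_notin.
by rewrite (bigD1 N) //= inE NV is_triangle3.
Qed.

Lemma leq_bool3 (b1 b2 b3 c1 c2 c3 : bool) :
  (b1 -> c1) -> (b2 -> c2) -> (b3 -> c3) -> b1 + b2 + b3 <= c1 + c2 + c3.
Proof.
have le_bool (b c : bool) : (b -> c) -> b <= c by case: b => // ->.
by move=> bc1 bc2 bc3; rewrite !leq_add ?le_bool.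
Qed.

Lemma edge_in_edges x y : e x y -> [set x; y] \in edges e.
Proof. by move=> xy; apply/imsetP; exists (x, y); rewrite ?inE. Qed.

Lemma leq_cost_count w Q (D : {set T}) k : w \in weights -> is_triangle e D ->
  k <= edge_count Q D -> cost w (edge_count Q D) <= cost w k.
Proof.
move=> w_in D_tri le_k; apply: leq_cost => //.
by rewrite le_k -(triangle_card _ D_tri) edge_count_card.
Qed.

Lemma leq_gain_count w Q (D : {set T}) k : w \in weights -> is_triangle e D ->
  k <= edge_count Q D -> gain w k <= gain w (edge_count Q D).
Proof.
move=> w_in D_tri le_k; apply: leq_gain => //.
by rewrite le_k -(triangle_card _ D_tri) edge_count_card.
Qed.

Lemma balanced_setU1 (V : {set T}) v p q r :
    v \notin V -> [set y in V | e v y] = [set p; q; r] ->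
    e p q -> e q r -> e p r ->
  balanced V -> balanced (v |: V).
Proof.
move=> vV nbrs pq qr pr V_bal sigma sigma_in.
have ne u w : e u w -> u != w.
  by move=> uw; apply/eqP => eq_uw; rewrite eq_uw e_irr in uw.
have nbrE y : (y \in V) && e v y = (y \in [set p; q; r]) by rewrite -nbrs inE.
have [/andP[pV vp] /andP[qV vq] /andP[rV vr]] :
    [/\ (p \in V) && e v p, (q \in V) && e v q & (r \in V) && e v r].
  by rewrite !nbrE !inE !eqxx !orbT.
set N := [set p; q; r]; set D1 := [set v; p; q].
set D2 := [set v; q; r]; set D3 := [set v; r; p].
have N_tri : N \in triangles V.
  rewrite inE is_triangle3 //=; apply/subsetP => y.
  by rewrite -nbrE => /andP[].
have [w w_in absorb] :=
  absorb_vertex _ _ _ _ (sigma_in N) (sigma_in D1) (sigma_in D2) (sigma_in D3).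
(* The induction hypothesis is applied with [N] carrying the single weight that stands for all four
   triangles. *)
pose sigma' D := if D == N then w else sigma D.
have sigma'_in D : sigma' D \in weights by rewrite /sigma'; case: ifP.
have [F [phi [F_sub le_F_phi]]] := V_bal sigma' sigma'_in.
have [u1 [u2 [u3 [z1 [z2 [z3 [v1 [v2 [v3 [a1 [a2 [a3 absorb_le]]]]]]]]]]]] :=
  absorb ([set p; q] \in F) ([set q; r] \in F) ([set p; r] \in F)
    (phi [set p; q] == N) (phi [set q; r] == N) (phi [set p; r] == N).
pose opt (b : bool) (f : {set T}) := if b then [set f] else set0.
have opt_card b f : #|opt b f| = b.
  by rewrite /opt; case: b; rewrite ?cards1 ?cards0.
have opt_mem b f g : (g \in opt b f) = b && (g == f).
  by rewrite /opt; case: b; rewrite !inE.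
pose F2 := F :|: opt u1 [set p; q] :|: opt u2 [set q; r] :|: opt u3 [set p; r]
  :|: opt z1 [set v; p] :|: opt z2 [set v; q] :|: opt z3 [set v; r].
(* Only edges at [v] and edges owned by [N] get a new owner; membership of [v], [p], [q] tells these
   edges apart. *)
pose phi2 (f : {set T}) : {set T} :=
  if v \in f then
    if p \in f then (if a1 then D1 else D3)
    else if q \in f then (if a2 then D1 else D2) else (if a3 then D2 else D3)
  else if phi f == N then
    if p \in f then
      if q \in f then (if v1 then D1 else N) else (if v3 then D3 else N)
    else (if v2 then D2 else N)
  else phi f.
have F2E g : (g \in F2) = [|| g \in F, u1 && (g == [set p; q]), u2 && (g == [set q; r]),
    u3 && (g == [set p; r]), z1 && (g == [set v; p]), z2 && (g == [set v; q])
    | z3 && (g == [set v; r])].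
  by rewrite /F2 !in_setU !opt_mem -!orbA.
have F_F2 : F \subset F2 by apply/subsetP => f fF; rewrite F2E fF.
exists F2, phi2; split.
  have opt_sub b x y : e x y -> opt b [set x; y] \subset edges e.
    by move=> xy; apply/subsetP => f; rewrite opt_mem => /andP[_ /eqP->]; apply: edge_in_edges.
  by rewrite !subUset F_sub !opt_sub.
(* Only an upper bound, since an added edge may already lie in [F]. *)
have F2_card : #|F2| <= #|F| + (u1 + u2 + u3 + z1 + z2 + z3).
  have le_card (A : {set {set T}}) b f : #|A :|: opt b f| <= #|A| + b.
    by apply: leq_trans (leq_card_setU _ _) _; rewrite opt_card.
  by rewrite !addnA; do ![apply: leq_trans (le_card _ _ _) _; rewrite leq_add2r].
have [D1_tri D2_tri D3_tri N_tri'] : [/\ is_triangle e D1, is_triangle e D2,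
    is_triangle e D3 & is_triangle e N].
  by rewrite !is_triangle3 // e_sym.
have [/negPf pv /negPf qv /negPf rv] : [/\ p != v, q != v & r != v].
  by rewrite ![_ == v]eq_sym !ne.
have [/negPf vp' /negPf vq' /negPf vr'] : [/\ v != p, v != q & v != r] by rewrite !ne.
have [/negPf pq' /negPf qr' /negPf pr'] : [/\ p != q, q != r & p != r] by rewrite !ne.
have [/negPf qp' /negPf rq' /negPf rp'] : [/\ q != p, r != q & r != p].
  by rewrite (eq_sym q) (eq_sym r q) (eq_sym r p) pq' qr' pr'.
have count_N Q : edge_count Q N = Q [set p; q] + Q [set q; r] + Q [set p; r].
  by apply: edge_count3; apply: ne.
have count_D1 Q : edge_count Q D1 = Q [set p; q] + Q [set v; p] + Q [set v; q].
  by rewrite edge_count3 ?ne // (addnC (Q _)).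
have count_D2 Q : edge_count Q D2 = Q [set q; r] + Q [set v; q] + Q [set v; r].
  by rewrite edge_count3 ?ne // (addnC (Q _)).
have count_D3 Q : edge_count Q D3 = Q [set p; r] + Q [set v; r] + Q [set v; p].
  by rewrite edge_count3 ?ne // 1?e_sym // [[set r; p]]setUC (addnC (Q _)).
have phi2_vp : phi2 [set v; p] = if a1 then D1 else D3.
  by rewrite /phi2 !inE !eqxx !orbT.
have phi2_vq : phi2 [set v; q] = if a2 then D1 else D2.
  by rewrite /phi2 !inE !eqxx pv pq' orbT.
have phi2_vr : phi2 [set v; r] = if a3 then D2 else D3.
  by rewrite /phi2 !inE !eqxx pv pr' qv qr'.
have phi2_pq : phi [set p; q] = N -> phi2 [set p; q] = if v1 then D1 else N.
  by rewrite /phi2 => ->; rewrite !inE !eqxx vp' vq' orbT.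
have phi2_qr : phi [set q; r] = N -> phi2 [set q; r] = if v2 then D2 else N.
  by rewrite /phi2 => ->; rewrite !inE !eqxx vq' vr' pq' pr'.
have phi2_pr : phi [set p; r] = N -> phi2 [set p; r] = if v3 then D3 else N.
  by rewrite /phi2 => ->; rewrite !inE !eqxx vp' vr' qp' qr'.
have cost_N : cost (sigma N) (cut_count F2 N) <= cost (sigma N)
    ((([set p; q] \in F) || u1) + (([set q; r] \in F) || u2) + (([set p; r] \in F) || u3)).
  apply: leq_cost_count => //; rewrite /cut_count count_N; apply: leq_bool3; rewrite /= F2E eqxx;
    by case/orP => ->; rewrite ?orbT.
have cost_D1 : cost (sigma D1) (cut_count F2 D1) <= cost (sigma D1)
    ((([set p; q] \in F) || u1) + z1 + z2).
  apply: leq_cost_count => //; rewrite /cut_count count_D1; apply: leq_bool3; rewrite /= F2E eqxx;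
    by [case/orP => ->; rewrite ?orbT | move=> ->; rewrite ?orbT].
have cost_D2 : cost (sigma D2) (cut_count F2 D2) <= cost (sigma D2)
    ((([set q; r] \in F) || u2) + z2 + z3).
  apply: leq_cost_count => //; rewrite /cut_count count_D2; apply: leq_bool3; rewrite /= F2E eqxx;
    by [case/orP => ->; rewrite ?orbT | move=> ->; rewrite ?orbT].
have cost_D3 : cost (sigma D3) (cut_count F2 D3) <= cost (sigma D3)
    ((([set p; r] \in F) || u3) + z3 + z1).
  apply: leq_cost_count => //; rewrite /cut_count count_D3; apply: leq_bool3; rewrite /= F2E eqxx;
    by [case/orP => ->; rewrite ?orbT | move=> ->; rewrite ?orbT].
have gain_N : gain (sigma N) (((phi [set p; q] == N) && ~~ v1)
    + ((phi [set q; r] == N) && ~~ v2) + ((phi [set p; r] == N) && ~~ v3))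
    <= gain (sigma N) (owned_count phi2 N).
  apply: leq_gain_count => //; rewrite /owned_count count_N; apply: leq_bool3;
    case/andP => /eqP phiE /negPf vF; by rewrite (phi2_pq, phi2_qr, phi2_pr) ?vF.
have gain_D1 : gain (sigma D1) (((phi [set p; q] == N) && v1) + a1 + a2)
    <= gain (sigma D1) (owned_count phi2 D1).
  apply: leq_gain_count => //; rewrite /owned_count count_D1; apply: leq_bool3.
  - by case/andP => /eqP phiE v1T; rewrite phi2_pq ?v1T.
  - by move=> a1T; rewrite phi2_vp a1T.
  - by move=> a2T; rewrite phi2_vq a2T.
have gain_D2 : gain (sigma D2) (((phi [set q; r] == N) && v2) + ~~ a2 + a3)
    <= gain (sigma D2) (owned_count phi2 D2).
  apply: leq_gain_count => //; rewrite /owned_count count_D2; apply: leq_bool3.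
  - by case/andP => /eqP phiE v2T; rewrite phi2_qr ?v2T.
  - by move=> /negPf a2F; rewrite phi2_vq a2F.
  - by move=> a3T; rewrite phi2_vr a3T.
have gain_D3 : gain (sigma D3) (((phi [set p; r] == N) && v3) + ~~ a3 + ~~ a1)
    <= gain (sigma D3) (owned_count phi2 D3).
  apply: leq_gain_count => //; rewrite /owned_count count_D3; apply: leq_bool3.
  - by case/andP => /eqP phiE v3T; rewrite phi2_pr ?v3T.
  - by move=> /negPf a3F; rewrite phi2_vr a3F.
  - by move=> /negPf a1F; rewrite phi2_vp a1F.
have cost_rest : \sum_(D in triangles V | D != N) cost (sigma D) (cut_count F2 D)
    <= \sum_(D in triangles V | D != N) cost (sigma' D) (cut_count F D).
  apply: leq_sum => D /andP[]; rewrite inE /sigma' => /andP[D_tri D_sub] /negPf ->.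
  by apply: leq_cost_count => //; apply: leq_edge_count => x xD; apply: (subsetP F_F2).
have gain_rest : \sum_(D in triangles V | D != N)
      gain (sigma' D) (owned_count phi D)
    <= \sum_(D in triangles V | D != N) gain (sigma D) (owned_count phi2 D).
  (* An edge owned by such a [D] avoids [v] and is not owned by [N], so [phi2] leaves its owner
     unchanged. *)
  apply: leq_sum => D /andP[]; rewrite inE /sigma' => /andP[D_tri D_sub] /negPf D_N.
  rewrite D_N; apply: leq_gain_count => //; apply: leq_edge_count => x xD /eqP phiD.
  rewrite /phi2 phiD D_N ifN //; apply: contra vV.
  by rewrite !inE => /andP[_]; apply: (subsetP D_sub).
have splitN (g : {set T} -> nat) : \sum_(D in triangles V) g D =
    g N + \sum_(D in triangles V | D != N) g D by rewrite (bigD1 N N_tri).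
have sigma'N : sigma' N = w by rewrite /sigma' eqxx.
rewrite !(triangles_setU1 _ _ _ _ _ vV nbrs pq qr pr) -/N -/D1 -/D2 -/D3.
move: le_F_phi absorb_le F2_card cost_N cost_D1 cost_D2 cost_D3 gain_N gain_D1 gain_D2 gain_D3.
move: cost_rest gain_rest; rewrite !splitN !sigma'N /cut_count /owned_count !count_N.
do !move: (bigop _ _ _) => ?.
do !move: (cost _ _) => ?; do !move: (gain _ _) => ?.
move: #|_| #|_| => ? ?.
do !move: (nat_of_bool _) => ?.
clear. lia.
Qed.

Lemma is_3tree_balanced : is_3tree e -> balanced [set: T].
Proof.
case=> a [b [c [rest]]]; set s := [:: a, b, c & rest].
case=> s_uniq s_all /and3P[ab bc ac] s_step.
have -> : [set: T] = [set y in take (size s) s].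
  by apply/setP => y; rewrite in_setT in_set take_size s_all.
suff prefix_balanced i : 3 <= i <= size s -> balanced [set y in take i s].
  by apply: prefix_balanced; rewrite leqnn.
elim: i => // i IHi /andP[]; rewrite ltnS leq_eqVlt => /orP[/eqP <- _|i_ge3 i_lt].
  have -> : [set y in take 3 s] = [set a; b; c].
    by apply/setP => y; rewrite /= take0 !inE orbA.
  exact: balanced_triangle.
have [|p [q [r [nbrs _ /and3P[pq qr pr]]]]] := s_step i; first by rewrite i_ge3 i_lt.
rewrite (take_nth a i_lt).
have -> : [set y in rcons (take i s) (nth a s i)] = nth a s i |: [set y in take i s].
  by apply/setP => y; rewrite !inE mem_rcons inE.
apply: balanced_setU1 pq qr pr _; last by apply: IHi; rewrite i_ge3 ltnW.
  have := take_uniq i.+1 s_uniq; rewrite (take_nth a i_lt) rcons_uniq inE.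
  by case/andP.
by rewrite -nbrs; apply/setP => y; rewrite !inE.
Qed.

(** * From balance to bounds on tau and nu *)

Lemma tau_leq (F : {set {set T}}) :
  F \subset edges e -> hits_all_triangles e F -> tau e <= #|F|.
Proof.
move=> F_sub F_hits; rewrite /tau.
(* The default [#|edges e|] is not neutral for [minn], so the bound is proved by induction on the
   list of candidate sets. *)
have : F \in index_enum _ by rewrite mem_index_enum.
elim: (index_enum _) => // A r IHr; rewrite inE big_cons => /orP[/eqP <-|/IHr le_r].
  by rewrite F_sub F_hits geq_minl.
by case: ifP => // _; apply: leq_trans le_r; apply: geq_minr.
Qed.

Lemma subset_triangle_pair D x : is_triangle e D -> x \in D ->
  exists y z, [/\ y \in D, z \in D, y != z & D :\ x = [set y; z]].
Proof.
move=> D_tri xD; have := cardsD1_3 _ _ (triangle_card _ D_tri) xD.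
move=> /eqP/cards2P[y [z [yz Dx]]]; exists y, z.
have : (y \in D :\ x) && (z \in D :\ x) by rewrite Dx !inE !eqxx orbT.
by rewrite !in_setD1 => /andP[/andP[_ ->] /andP[_ ->]].
Qed.

(* Instead of paying the penalty, delete one edge of each triangle missed by [F]. *)
Lemma tau_leq_penalised (F : {set {set T}}) : F \subset edges e ->
  tau e <= #|F| + \sum_(D in triangles [set: T]) (cut_count F D == 0).
Proof.
move=> F_sub.
pose missed := [set D in triangles [set: T] | cut_count F D == 0].
(* An arbitrary edge of [D]; a triangle is nonempty, so the default [set0] never arises for it. *)
pose side (D : {set T}) := if [pick x in D] is Some x then D :\ x else set0.
have missed_card : \sum_(D in triangles [set: T]) (cut_count F D == 0) = #|missed|.
  rewrite -sum1_card big_mkcond [RHS]big_mkcond; apply: eq_bigr => D _.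
  by rewrite [in RHS]inE; case: (D \in _) => //=; case: (_ == 0).
have sideP D : is_triangle e D -> exists2 x, x \in D & side D = D :\ x.
  move=> D_tri; rewrite /side; case: pickP => [x xD|D0]; first by exists x.
  by have := triangle_card _ D_tri; rewrite (eq_card0 D0).
rewrite missed_card.
apply: (@leq_trans #|F :|: side @: missed|); last first.
  by apply: leq_trans (leq_card_setU _ _) _; rewrite leq_add2l leq_imset_card.
apply: tau_leq.
  rewrite subUset F_sub; apply/subsetP => f /imsetP[D]; rewrite !inE.
  case/andP => /andP[D_tri _] _ ->; have [x xD ->] := sideP D D_tri.
  have [y [z [yD zD yz ->]]] := subset_triangle_pair _ _ D_tri xD.
  by apply: edge_in_edges; apply: triangle_adj D_tri yD zD yz.
apply/forallP => D; apply/implyP => D_tri.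
have [x xD fD] : exists2 x, x \in D & D :\ x \in F :|: side @: missed.
  (* [D_cut] is the case of count zero, where [side D] was added; otherwise [F] already contains an
     edge of [D]. *)
  have [D_cut|D_missed] := posnP (cut_count F D); last first.
    move: D_missed; rewrite lt0n sum_nat_eq0 negb_forall => /existsP[x].
    by rewrite negb_imply eqb0 negbK => /andP[xD xF]; exists x => //; rewrite inE xF.
  have [x xD sideE] := sideP D D_tri; exists x => //.
  by rewrite inE -sideE imset_f ?orbT // !inE D_tri subsetT D_cut.
have [y [z [yD zD yz DE]]] := subset_triangle_pair _ _ D_tri xD.
apply/exists_inP; exists y => //; apply/exists_inP; exists z => //.
by rewrite yz -DE.
Qed.

(** Triangles owning all their edges form a packing: two distinct ones with two common vertices
    would share an edge, on which [phi] would take two values. *)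
Lemma nu_geq_owned (phi : {set T} -> {set T}) :
  \sum_(D in triangles [set: T]) (owned_count phi D == 3) <= nu e.
Proof.
pose P := [set D in triangles [set: T] | owned_count phi D == 3].
have -> : \sum_(D in triangles [set: T]) (owned_count phi D == 3) = #|P|.
  rewrite -sum1_card big_mkcond [RHS]big_mkcond; apply: eq_bigr => D _.
  by rewrite [in RHS]inE; case: (D \in _) => //=; case: (_ == 3).
have P_tri D : D \in P -> is_triangle e D by rewrite !inE => /andP[/andP[]].
have owned D x : D \in P -> x \in D -> phi (D :\ x) = D.
  move=> DP xD; have D_card := triangle_card _ (P_tri D DP); apply/eqP.
  move: DP; rewrite !inE => /andP[_]; apply: contraTT => not_owned.
  rewrite /owned_count /edge_count (bigD1 x xD) /= (negPf not_owned) add0n.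
  rewrite neq_ltn (@leq_ltn_trans #|D :\ x|) //.
    rewrite -sum1_card; under [leqRHS]eq_bigl => y do rewrite in_setD1 andbC.
    by apply: leq_sum => y _; apply: leq_b1.
  by rewrite cardsD1_3.
apply: (@leq_bigmax_cond _ (triangle_packing e) (fun Q : {set {set T}} => #|Q|) P).
apply/andP; split; first by apply/forall_inP.
apply/forall_inP => D D_P; apply/forall_inP => D' D'_P; apply/implyP => DD'.
rewrite leqNgt; apply: contra DD' => I_gt1.
have D_card := triangle_card _ (P_tri D D_P).
have D'_card := triangle_card _ (P_tri D' D'_P).
have remove_one (A B : {set T}) : #|A| = 3 -> #|B| = 3 -> 1 < #|A :&: B| -> A != B ->
    exists2 x, x \in A & A :\ x = A :&: B.
  move=> A_card B_card AB_gt1 neqAB.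
  have /subsetPn[x xA xB] : ~~ (A \subset B).
    by apply: contra neqAB => AB; rewrite eqEcard AB A_card B_card.
  exists x => //; apply/esym/eqP; rewrite eqEcard.
  rewrite cardsD1_3 // AB_gt1 andbT.
  apply/subsetP => y; rewrite !inE => /andP[yA yB]; rewrite yA andbT.
  by apply: contraNneq xB => <-.
apply: contraLR I_gt1 => neqDD'; rewrite -leqNgt leqNgt; apply/negP => I_gt1.
have [x xD DxE] := remove_one D D' D_card D'_card I_gt1 neqDD'.
have [y yD' DyE] : exists2 y, y \in D' & D' :\ y = D' :&: D.
  by apply: remove_one => //; rewrite 1?setIC // eq_sym.
have : phi (D :\ x) = phi (D' :\ y) by rewrite DxE DyE setIC.
by rewrite !owned // => /eqP; rewrite (negPf neqDD').
Qed.

End Elimination.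

Local Open Scope ring_scope.

Theorem theorem5p1 (T : finType) (e : rel T)
    (e_sym : symmetric e) (e_irr : irreflexive e) :
  is_3tree e ->
  ((tau e)%:R : rat) <= 9 / 5 * (nu e)%:R + 1 / 5.
Proof.
move=> e_3tree.
have [|F [phi [F_sub le_F_phi]]] :=
  is_3tree_balanced _ _ e_sym e_irr e_3tree (fun=> triangle_weight); first by [].
(* Beyond index 3 [nth] returns 0, so both formulas hold for every [k]: 5 for a missed triangle, 9
   for a fully owned one. *)
have costE k : cost triangle_weight k = (5 * (k == 0))%N by case: k => [|[|[|[|[]]]]].
have gainE k : gain triangle_weight k = (9 * (k == 3))%N by case: k => [|[|[|[|[]]]]].
have tau_nu : (5 * tau e <= 9 * nu e + 1)%N.
  have tau_le := tau_leq_penalised _ _ F F_sub.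
  have nu_ge := nu_geq_owned _ e phi.
  move: le_F_phi; under eq_bigr do rewrite costE.
  under [X in (_ <= X + _)%N]eq_bigr do rewrite gainE.
  rewrite -!big_distrr /=; move: tau_le nu_ge.
  move: (tau e) (nu e) #|F| => t n k; do !move: (bigop _ _ _) => ?; lia.
have : ((5 * tau e)%:R <= (9 * nu e + 1)%:R :> rat) by rewrite ler_nat.
by rewrite natrD !natrM; lra.
Qed.
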